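(* Let $n,\lambda\ge2$ be even integers, $m=1+\frac{\lambda}{2}$, $\sigma>0$, $b_0>0$ and $0<\delta<\frac{b_0}{2(m+1)}$. Let $\rho$, $c_0$, $c_1$, $k$ and the function $MN:[c_0,\infty)\to(0,\infty)$ be as defined in the context. If $\lambda-n-1<0$ and $k\ge0$, then there exist $c^*\in[c_0,c_1]$ minimizing $MN$ on $[c_0,c_1]$ and $c^{**}\in[c_1,\infty)$ minimizing $MN$ on $[c_1,\infty)$, and for any such $c^*,c^{**}$ the optimal choice of $c\in[c_0,\infty)$ is $c^*$ if $MN(c^* )\le MN(c^{**})$, and $c^{**}$ if $MN(c^{**})\le MN(c^* )$.
   Context: The constant $\rho$ is: $\rho=1+\frac{s}{2m+3}$ with $s=\lceil\frac{n-\lambda-3}{2}\rceil$ if $n-\lambda>3$; $\rho=1$ if $n-\lambda\le3$. $c_0:=24\rho(m+1)\delta$, $c_1:=12\rho b_0$, $k:=\frac{\sigma}{2}+\frac{\ln\frac23}{24\rho\delta}$. The MN function (for band-limited functions in $B_\sigma$, with $b_0$ fixed) is $$MN(c)=\begin{cases}\sqrt{8\rho}\,c^{\frac{\lambda-n-1}{4}}e^{c\left[\frac{\sigma}{2}+\frac{\ln\frac23}{24\rho\delta}\right]} & c_0\le c\le c_1,\\[1ex] \sqrt{\frac{2}{3b_0}}\,c^{\frac{1+\lambda-n}{4}}e^{\frac{c\sigma}{2}}\left(\frac23\right)^{\frac{b_0}{2\delta}} & c_1\le c<\infty.\end{cases}$$ The two formulas agree at $c=c_1$. A value of $c\in[c_0,\infty)$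 is called optimal if it minimizes $MN$ over $[c_0,\infty)$. *)

(* Defs.v *)
From HB Require Import structures.
From mathcomp Require Import all_boot all_order all_algebra.
From mathcomp Require Import all_classical all_reals all_analysis.

Set Implicit Arguments.
Unset Strict Implicit.
Unset Printing Implicit Defensive.

Import Order.TTheory GRing.Theory Num.Theory.

Local Open Scope classical_set_scope.
Local Open Scope ring_scope.

Definition m_of (R : realType) (lambda : nat) : R := 1 + lambda%:R / 2.

Definition s_of (R : realType) (n lambda : nat) : int :=
  Num.ceil ((n%:R - lambda%:R - 3) / 2 : R).

Definition rho_of (R : realType) (n lambda : nat) : R :=
  if (3 < n%:Z - lambda%:Z)
  then 1 + (s_of R n lambda)%:~R / (2 * m_of R lambda + 3)
  else 1.

Definition c0_of (R : realType) (n lambda : nat) (delta : R) : R :=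
  24 * rho_of R n lambda * (m_of R lambda + 1) * delta.

Definition c1_of (R : realType) (n lambda : nat) (b0 : R) : R :=
  12 * rho_of R n lambda * b0.

Definition k_of (R : realType) (n lambda : nat) (sigma delta : R) : R :=
  sigma / 2 + ln (2 / 3) / (24 * rho_of R n lambda * delta).

(* Total on R; only its values on [c0, +oo[ are meaningful. The two formulas
   agree at c1, so assigning c1 to the first branch is harmless. *)
Definition MN (R : realType) (n lambda : nat) (sigma b0 delta c : R) : R :=
  if c <= c1_of n lambda b0
  then Num.sqrt (8 * rho_of R n lambda)
       * c `^ ((lambda%:R - n%:R - 1) / 4)
       * expR (c * k_of n lambda sigma delta)
  else Num.sqrt (2 / (3 * b0))
       * c `^ ((1 + lambda%:R - n%:R) / 4)
       * expR (c * sigma / 2)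
       * (2 / 3) `^ (b0 / (2 * delta)).

Definition minimizes_on (R : realType) (f : R -> R) (A : set R) (c : R) : Prop :=
  A c /\ forall x, A x -> f c <= f x.

Definition optimal (R : realType) (n lambda : nat) (sigma b0 delta c : R) : Prop :=
  minimizes_on (MN n lambda sigma b0 delta)
    [set x | c0_of n lambda delta <= x] c.

(* Main.v *)
Require Import Defs.
From HB Require Import structures.
From mathcomp Require Import all_boot all_order all_algebra.
From mathcomp Require Import all_classical all_reals all_analysis.
From mathcomp Require Import ring lra.

Set Implicit Arguments.
Unset Strict Implicit.
Unset Printing Implicit Defensive.

Import Order.TTheory GRing.Theory Num.Theory.
Import numFieldNormedType.Exports.

Local Open Scope classical_set_scope.
Local Open Scope ring_scope.

(** Both branches of [MN] have the shape [K * exp (p * ln c + a * c)] with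
    [K >= 0], and they agree at [c1].  On [[c0, c1]] a minimum exists by
    compactness.  On [[c1, +oo[] we have [a = sigma / 2 > 0], and
    [ln y - ln x <= (y - x) / x] makes the exponent nondecreasing beyond
    [|p| / a], so that half-line too reduces to a compact interval. *)

Section AffineLog.
Variable R : realType.
Implicit Types (a b p x y : R) (f g : R -> R).

Lemma minimizes_on_ext (A : set R) f g c :
  (forall x, A x -> f x = g x) -> minimizes_on g A c -> minimizes_on f A c.
Proof. by move=> fg [Ac cmin]; split=> // x Ax; rewrite !fg//; exact: cmin. Qed.

(** As the exponential is increasing, a minimizer of the exponent also minimizes the whole
    branch. *)
Lemma minimizes_on_expR (A : set R) f K c :
  0 <= K -> minimizes_on f A c ->
  minimizes_on (fun x => K * expR (f x)) A c.
Proof.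
by move=> K0 [Ac cmin]; split=> // x Ax; rewrite ler_wpM2l// ler_expR; exact: cmin.
Qed.

Lemma minimizes_on_setU (A B : set R) f c d :
  minimizes_on f A c -> minimizes_on f B d -> f c <= f d ->
  minimizes_on f (A `|` B) c.
Proof.
move=> [Ac cmin] [_ dmin] cd; split=> [|x [/cmin//|/dmin]]; first by left.
exact: le_trans.
Qed.

(** This is [ln (1 + t) <= t] at [t = y / x - 1], which exceeds -1 by positivity of [x] and [y]. *)
Lemma ln_sub_le x y : 0 < x -> 0 < y -> ln y - ln x <= (y - x) / x.
Proof.
move=> x0 y0; rewrite -ln_div// mulrBl divff ?gt_eqF//.
rewrite -[X in ln X](subrKC 1) le_ln1Dx//.
by rewrite ltrBrDr addNr divr_gt0.
Qed.

Lemma continuous_affine_log p a x :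
  0 < x -> {for x, continuous (fun y => p * ln y + a * y)}.
Proof.
move=> x0; apply: cvgD; apply: cvgM; try exact: cvg_cst; last exact: cvg_id.
exact: continuous_ln.
Qed.

Lemma affine_log_min_itv p a b c : 0 < b -> b <= c ->
  exists d, minimizes_on (fun y => p * ln y + a * y) [set x | b <= x <= c] d.
Proof.
move=> b0 bc.
have [|d dbc dmin] := @EVT_min R (fun y => p * ln y + a * y) b c bc.
  apply: continuous_in_subspaceT => x; rewrite inE/= in_itv/= => /andP[bx _].
  exact/continuous_affine_log/(lt_le_trans b0).
by exists d; split=> [|x xbc]; [move: dbc|apply: dmin]; rewrite in_itv.
Qed.

Lemma affine_log_nondecreasing p a x y :
  0 < x -> 0 < a -> `|p| / a <= x -> x <= y ->
  p * ln x + a * x <= p * ln y + a * y.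
Proof.
move=> x0 a0 pax xy.
have y0 : 0 < y by exact: lt_le_trans xy.
have lnxy : 0 <= ln y - ln x by rewrite subr_ge0 ler_ln.
have pa : `|p| <= a * x by rewrite mulrC -ler_pdivrMr.
have h1 : - p * (ln y - ln x) <= `|p| * (ln y - ln x).
  by rewrite ler_wpM2r// -normrN ler_norm.
(* The threshold gives [|p| <= a * x]; the factor [x] then cancels, so the logarithmic term loses at
   most the gain [a * (y - x)]. *)
have h2 : `|p| * (ln y - ln x) <= a * x * ((y - x) / x).
  by apply: ler_pM => //; exact: ln_sub_le.
have h3 : a * x * ((y - x) / x) = a * (y - x) by field; rewrite gt_eqF.
move: h1 h2; rewrite h3; lra.
Qed.

Lemma affine_log_min_ray p a b : 0 < b -> 0 < a ->
  exists d, minimizes_on (fun y => p * ln y + a * y) [set x | b <= x] d.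
Proof.
(* The sum lies beyond both [b] and the monotonicity threshold: past [c] no value drops below the
   one at [c], itself bounded below by the minimum on [[b, c]]. *)
move=> b0 a0; pose c := b + `|p| / a.
have pa0 : 0 <= `|p| / a by rewrite divr_ge0// ltW.
have bc : b <= c by rewrite lerDl.
have [d [/andP[bd dc] dmin]] := affine_log_min_itv p a b0 bc.
exists d; split=> // x bx; have [xc|cx] := leP x c.
  by apply: dmin; rewrite /= bx.
apply: le_trans (dmin c _) _; first by rewrite /= bc lexx.
apply: affine_log_nondecreasing => //; last exact: ltW.
  exact: lt_le_trans bc.
by rewrite lerDr ltW.
Qed.

End AffineLog.

Section MN.
Variables (R : realType) (n lambda : nat) (sigma b0 delta : R).

Lemma rho_gt0 : 0 < rho_of R n lambda.
Proof.
rewrite /rho_of; case: ifPn => // nl.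
apply: ltr_wpDr => //; apply: divr_ge0; last first.
  by rewrite /m_of; have := ler0n R lambda; lra.
rewrite ler0z /s_of ceil_ge0.
(* Moved from integers to reals, the case condition makes the argument of the ceiling positive. *)
have : (3%:~R : R) < (n%:Z - lambda%:Z)%:~R by rewrite ltr_int.
rewrite intrB -!pmulrn => nl'; lra.
Qed.

Lemma m_of_gt0 : 0 < m_of R lambda.
Proof. by rewrite /m_of; have := ler0n R lambda; lra. Qed.

Lemma c0_gt0 : 0 < delta -> 0 < c0_of n lambda delta.
Proof.
move=> delta0; have m0 := m_of_gt0; have r0 := rho_gt0.
by rewrite /c0_of !mulr_gt0//; lra.
Qed.

Lemma c1_gt0 : 0 < b0 -> 0 < c1_of n lambda b0.
Proof. by move=> b00; have r0 := rho_gt0; rewrite /c1_of !mulr_gt0. Qed.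

Lemma c0_le_c1 : delta < b0 / (2 * (m_of R lambda + 1)) ->
  c0_of n lambda delta <= c1_of n lambda b0.
Proof.
have m0 := m_of_gt0; have r0 := rho_gt0.
rewrite ltr_pdivlMr; last lra.
move=> h; rewrite /c0_of /c1_of.
have -> : 24 * rho_of R n lambda * (m_of R lambda + 1) * delta =
   12 * rho_of R n lambda * (delta * (2 * (m_of R lambda + 1))) by ring.
by rewrite ler_wpM2l ?ltW// mulr_gt0.
Qed.

Lemma MN_left c : 0 < c -> c <= c1_of n lambda b0 ->
  MN n lambda sigma b0 delta c =
  Num.sqrt (8 * rho_of R n lambda) *
  expR ((lambda%:R - n%:R - 1) / 4 * ln c + k_of n lambda sigma delta * c).
Proof.
(* [powR] treats base 0 separately; [0 < c] selects the form [expR (p * ln c)]. *)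
move=> c0 cc1; rewrite /MN cc1 /powR gt_eqF// -mulrA -expRD.
by rewrite [c * _]mulrC.
Qed.

(** Moves the prefactors into the exponent, where agreement at [c1] is an identity linear in
    logarithms. *)
Lemma sqrt_expR_ln x : 0 < x -> Num.sqrt x = expR (ln x / 2) :> R.
Proof. by move=> x0; rewrite -powR12_sqrt ?ltW// /powR gt_eqF// mulrC. Qed.

(* The strict branch of [MN] extends to [c1] because [8 rho / c1 = 2 / (3 b0)]
   and [c1 / (24 rho delta) = b0 / (2 delta)]. *)
Lemma MN_right c : 0 < b0 -> 0 < delta -> c1_of n lambda b0 <= c ->
  MN n lambda sigma b0 delta c =
  Num.sqrt (2 / (3 * b0)) * (2 / 3) `^ (b0 / (2 * delta)) *
  expR ((1 + lambda%:R - n%:R) / 4 * ln c + sigma / 2 * c).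
Proof.
move=> b00 delta0 c1c; have r0 := rho_gt0.
have c10 := c1_gt0 b00.
have c0 : 0 < c by exact: lt_le_trans c1c.
have t0 : (0 : R) < 2 / 3 by lra.
have [cc1|cc1] := leP c (c1_of n lambda b0); last first.
  rewrite /MN leNgt cc1/= {1}/powR gt_eqF// expRD.
  by rewrite (_ : c * sigma / 2 = sigma / 2 * c); ring.
have {c1c cc1} -> : c = c1_of n lambda b0 by apply/eqP; rewrite eq_le cc1.
rewrite MN_left// /powR (gt_eqF t0).
rewrite !sqrt_expR_ln ?divr_gt0 ?mulr_gt0//.
rewrite -!expRD; congr expR.
(* Half of [ln c1] bridges the two powers: [(lambda - n - 1) / 4 + 1 / 2 = (1 + lambda - n) / 4]. *)
have -> : ln (8 * rho_of R n lambda) =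
    ln (2 / (3 * b0)) + ln (c1_of n lambda b0).
  rewrite -lnM ?posrE ?divr_gt0 ?mulr_gt0//; congr ln.
  by rewrite /c1_of; field; rewrite gt_eqF.
(* Naming [ln c1] keeps it atomic while [c1] is unfolded in the linear term. *)
rewrite /k_of; set L := ln (c1_of _ _ _); rewrite /c1_of.
by field; rewrite !gt_eqF.
Qed.

End MN.

Theorem mainTheorem6 (R : realType) (n lambda : nat) (sigma b0 delta : R)
  (n_ge2 : (2 <= n)%N) (n_even : ~~ odd n)
  (lambda_ge2 : (2 <= lambda)%N) (lambda_even : ~~ odd lambda)
  (sigma_gt0 : 0 < sigma) (b0_gt0 : 0 < b0)
  (delta_gt0 : 0 < delta)
  (delta_lt : delta < b0 / (2 * (m_of R lambda + 1)))
  (exponent_lt0 : lambda%:Z - n%:Z - 1 < 0)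
  (k_ge0 : 0 <= k_of n lambda sigma delta) :
  let c0 := c0_of n lambda delta in
  let c1 := c1_of n lambda b0 in
  let f := MN n lambda sigma b0 delta in
  let I0 := [set c : R | c0 <= c <= c1] in
  let I1 := [set c : R | c1 <= c] in
  [/\ (exists cs, minimizes_on f I0 cs),
      (exists css, minimizes_on f I1 css) &
      forall cs css : R, minimizes_on f I0 cs -> minimizes_on f I1 css ->
        (f cs <= f css -> optimal n lambda sigma b0 delta cs) /\
        (f css <= f cs -> optimal n lambda sigma b0 delta css)].
Proof.
move=> c0 c1 f I0 I1.
have c0_pos : 0 < c0 by exact: c0_gt0.
have c1_pos : 0 < c1 by exact: c1_gt0.
have c01 : c0 <= c1 by exact: c0_le_c1.
split.
- have [d dmin] := affine_log_min_itv ((lambda%:R - n%:R - 1) / 4)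
    (k_of n lambda sigma delta) c0_pos c01.
  exists d; apply: minimizes_on_ext (minimizes_on_expR _ dmin).
    by move=> x /andP[c0x xc1]; apply: MN_left => //; exact: lt_le_trans c0x.
  exact: sqrtr_ge0.
- have s0 : 0 < sigma / 2 by exact: divr_gt0.
  have [d dmin] := affine_log_min_ray ((1 + lambda%:R - n%:R) / 4)
    c1_pos s0.
  exists d; apply: minimizes_on_ext (minimizes_on_expR _ dmin).
    by move=> x c1x; exact: MN_right.
  by rewrite mulr_ge0 ?sqrtr_ge0 ?powR_ge0.
(* Since [c0 <= c1], the two pieces cover exactly the domain, so the smaller of the two minima is
   global. *)
- have I01 : [set x | c0 <= x] = I0 `|` I1.
    apply/seteqP; split=> x /=; last by case=> [/andP[]|]//; exact: le_trans.
    by move=> c0x; rewrite /I0 /I1/= c0x; have [|/ltW] := leP x c1; [left|right].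
  move=> cs css cs_min css_min; rewrite /optimal -/c0 I01; split=> [le|ge].
    exact: minimizes_on_setU css_min le.
  by rewrite setUC; exact: minimizes_on_setU cs_min ge.
Qed.
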